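(* There is an algorithm that, given any integer $n \ge 1$, any $k \in \{0, 1, \ldots, n\}$, any real $\Delta \ge 0$, any $x \in \mathbb{R}^n$ with at most $k$ nonzero components, and any $w \in \mathbb{R}^n$, computes in $O(n \log(n))$ operations an element $p(w)$ of the set $$P(w) := \operatorname{argmin}\ \{ \|w - y\|_2 \mid y \in C \}, \qquad C := k\mathbb{B}_0 \cap (x + \Delta \mathbb{B}_\infty),$$ that is, a global minimizer of $\|w-y\|_2$ over $y \in C$.
   Context: For $k \in \{0, \ldots, n\}$, $k\mathbb{B}_0 \subseteq \mathbb{R}^n$ denotes the set of vectors with at most $k$ nonzero components. For $\Delta \ge 0$ and $x \in \mathbb{R}^n$, $x + \Delta \mathbb{B}_\infty := \{ y \in \mathbb{R}^n \mid \|y - x\|_\infty \le \Delta \}$. The set $C$ is closed and contains $x$, so $P(w) \ne \varnothing$; since $C$ is nonconvex in general, $P(w)$ may contain several elements. Operations are elementary arithmetic operations on, and comparisons of, real numbers, each of unit cost; the constant hidden in $O(n\log(n))$ (as $n \to \infty$) is independent of $k$, $x$, $\Delta$ and $w$. *)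

(* Defs.v *)
From HB Require Import structures.
From mathcomp Require Import all_boot all_order all_algebra.
From mathcomp Require Import all_classical all_reals all_analysis.

Set Implicit Arguments.
Unset Strict Implicit.
Unset Printing Implicit Defensive.

Import Order.TTheory GRing.Theory Num.Theory.
Import numFieldNormedType.Exports.

Local Open Scope classical_set_scope.
Local Open Scope ring_scope.

(** * The optimization problem *)

Section Problem.
Context {R : realType} {n : nat}.
Implicit Types x y w : 'rV[R]_n.

Definition sparse (k : nat) : set 'rV[R]_n :=
  [set y : 'rV[R]_n | (#|[pred i : 'I_n | (y 0 i != 0)%R]| <= k)%N].

(* The library norm `|_| on matrices is the largest absolute value of an
   entry, i.e., the l_oo norm. *)
Definition box x (Delta : R) : set 'rV[R]_n := [set y : 'rV[R]_n | `|y - x| <= Delta].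

Definition norm2 x : R := Num.sqrt (\sum_i x 0 i ^+ 2).

Definition argmin (T : Type) (f : T -> R) (A : set T) : set T :=
  [set y | A y /\ forall z, A z -> f y <= f z].

Definition feasible (k : nat) x (Delta : R) : set 'rV[R]_n :=
  sparse k `&` box x Delta.

Definition projections (k : nat) x (Delta : R) w : set 'rV[R]_n :=
  argmin (fun y => norm2 (w - y)) (feasible k x Delta).

End Problem.

(** * The real RAM

   An algorithm is one finite program, the same for all inputs (in particular
   for all n).  Its memory has two sorts, naturals (sizes and indices) and exact
   reals, each organized as arrays: an array is named by a numeral of the
   program text and subscripted by a computed natural, so a program only uses
   finitely many arrays; a scalar variable is cell 0 of an array.
   Naturals only support addition, truncated subtraction and comparison, as in
   the usual unit-cost RAM, reals support the four field operations and
   comparison, and there is no conversion between the two sorts (no rounding). *)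

Inductive iexpr : Type :=
| INum of nat
| IGet of nat & iexpr            (* IGet a e : cell e of the index array a *)
| IAdd of iexpr & iexpr
| ISub of iexpr & iexpr.

Inductive rexpr : Type :=
| RNum of nat
| RGet of nat & iexpr            (* RGet a e : cell e of the real array a *)
| RAdd of rexpr & rexpr
| RSub of rexpr & rexpr
| RMul of rexpr & rexpr
| RDiv of rexpr & rexpr.

Inductive bexpr : Type :=
| BILe of iexpr & iexpr
| BIEq of iexpr & iexpr
| BRLe of rexpr & rexpr
| BREq of rexpr & rexpr
| BNot of bexpr
| BAnd of bexpr & bexpr.

Inductive cmd : Type :=
| Skip
| ISet of nat & iexpr & iexpr    (* ISet a i e : a[i] := e, index array *)
| RSet of nat & iexpr & rexpr    (* RSet a i e : a[i] := e, real array *)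
| Seq of cmd & cmd
| If of bexpr & cmd & cmd
| While of bexpr & cmd.

(* The cost of an expression is its number of nodes: one unit for each
   arithmetic operation, comparison, connective, memory access or constant.
   Index computations and data movement are thus charged like operations on
   reals. *)
Fixpoint icost (e : iexpr) : nat :=
  match e with
  | INum _ => 1
  | IGet _ e1 => (icost e1).+1
  | IAdd e1 e2 | ISub e1 e2 => (icost e1 + icost e2).+1
  end.

Fixpoint rcost (e : rexpr) : nat :=
  match e with
  | RNum _ => 1
  | RGet _ e1 => (icost e1).+1
  | RAdd e1 e2 | RSub e1 e2 | RMul e1 e2 | RDiv e1 e2 =>
      (rcost e1 + rcost e2).+1
  end.

Fixpoint bcost (b : bexpr) : nat :=
  match b with
  | BILe e1 e2 | BIEq e1 e2 => (icost e1 + icost e2).+1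
  | BRLe e1 e2 | BREq e1 e2 => (rcost e1 + rcost e2).+1
  | BNot b1 => (bcost b1).+1
  | BAnd b1 b2 => (bcost b1 + bcost b2).+1
  end.

Record state (R : realType) : Type := State {
  imem : nat -> nat -> nat;
  rmem : nat -> nat -> R
}.

Definition upd (V : Type) (m : nat -> nat -> V) (a i : nat) (v : V) :
    nat -> nat -> V :=
  fun b j => if (b == a) && (j == i) then v else m b j.

Section Semantics.
Context {R : realType}.
Implicit Types s : state R.

Fixpoint ieval s (e : iexpr) : nat :=
  match e with
  | INum c => c
  | IGet a e1 => imem s a (ieval s e1)
  | IAdd e1 e2 => (ieval s e1 + ieval s e2)%N
  | ISub e1 e2 => (ieval s e1 - ieval s e2)%N
  end.

(* Division is total, with x / 0 = 0; this can be simulated by a test at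
   constant extra cost. *)
Fixpoint reval s (e : rexpr) : R :=
  match e with
  | RNum c => c%:R
  | RGet a e1 => rmem s a (ieval s e1)
  | RAdd e1 e2 => reval s e1 + reval s e2
  | RSub e1 e2 => reval s e1 - reval s e2
  | RMul e1 e2 => reval s e1 * reval s e2
  | RDiv e1 e2 => reval s e1 / reval s e2
  end.

Fixpoint beval s (b : bexpr) : bool :=
  match b with
  | BILe e1 e2 => (ieval s e1 <= ieval s e2)%N
  | BIEq e1 e2 => ieval s e1 == ieval s e2
  | BRLe e1 e2 => reval s e1 <= reval s e2
  | BREq e1 e2 => reval s e1 == reval s e2
  | BNot b1 => ~~ beval s b1
  | BAnd b1 b2 => beval s b1 && beval s b2
  end.

(* [exec c s t s'] : the program c, started in s, halts in s' at total cost t. *)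
Inductive exec : cmd -> state R -> nat -> state R -> Prop :=
| exec_skip s : exec Skip s 1 s
| exec_iset a i e s :
    exec (ISet a i e) s (icost i + icost e).+1
      (State (upd (imem s) a (ieval s i) (ieval s e)) (rmem s))
| exec_rset a i e s :
    exec (RSet a i e) s (icost i + rcost e).+1
      (State (imem s) (upd (rmem s) a (ieval s i) (reval s e)))
| exec_seq c1 c2 s1 s2 s3 t1 t2 :
    exec c1 s1 t1 s2 -> exec c2 s2 t2 s3 -> exec (Seq c1 c2) s1 (t1 + t2) s3
| exec_if_true b c1 c2 s s' t :
    beval s b -> exec c1 s t s' -> exec (If b c1 c2) s (bcost b + t).+1 s'
| exec_if_false b c1 c2 s s' t :
    ~~ beval s b -> exec c2 s t s' -> exec (If b c1 c2) s (bcost b + t).+1 s'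
| exec_while_false b c s :
    ~~ beval s b -> exec (While b c) s (bcost b).+1 s
| exec_while_true b c s1 s2 s3 t1 t2 :
    beval s1 b -> exec c s1 t1 s2 -> exec (While b c) s2 t2 s3 ->
    exec (While b c) s1 (bcost b + t1 + t2).+1 s3.

Lemma exec_det c s t1 s1 t2 s2 :
  exec c s t1 s1 -> exec c s t2 s2 -> t1 = t2 /\ s1 = s2.
Proof.
move=> H; elim: H t2 s2 => {c s t1 s1}.
- by move=> s t2 s2 H; inversion H.
- by move=> a i e s t2 s2 H; inversion H.
- by move=> a i e s t2 s2 H; inversion H.
- move=> c1 c2 s1 s2 s3 t1 t2 _ IH1 _ IH2 t s H; inversion H; subst.
  have [? ?] := IH1 _ _ ltac:(eassumption); subst.
  by have [? ?] := IH2 _ _ ltac:(eassumption); subst.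
- move=> b c1 c2 s s' t bs _ IH t2 s2 H; inversion H; subst.
    by have [? ?] := IH _ _ ltac:(eassumption); subst.
  by exfalso; apply/negP: bs.
- move=> b c1 c2 s s' t bs _ IH t2 s2 H; inversion H; subst.
    by exfalso; apply/negP: bs; rewrite negbK.
  by have [? ?] := IH _ _ ltac:(eassumption); subst.
- move=> b c s bs t2 s2 H; inversion H; subst => //.
  by exfalso; apply/negP: bs; rewrite negbK.
- move=> b c s1 s2 s3 t1 t2 bs _ IH1 _ IH2 t s H; inversion H; subst.
    by exfalso; apply/negP: bs.
  have [? ?] := IH1 _ _ ltac:(eassumption); subst.
  by have [? ?] := IH2 _ _ ltac:(eassumption); subst.
Qed.

(* Input: n and k in cell 0 of the index arrays 0 and 1, Delta in cell 0 of the
   real array 0, x and w in the first n cells of the real arrays 1 and 2; all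
   other cells are 0. *)
Definition store_row n (x : 'rV[R]_n) (i : nat) : R :=
  if insub i is Some j then x 0 j else 0.

Definition input n (k : nat) (Delta : R) (x w : 'rV[R]_n) : state R :=
  State
    (fun a i => match a, i with 0, 0 => n | 1, 0 => k | _, _ => 0 end)%N
    (fun a i => match a with
                | 0%N => if i == 0%N then Delta else 0
                | 1%N => store_row x i
                | 2%N => store_row w i
                | _ => 0
                end).

(* Output: the first n cells of the real array 3. *)
Definition output n s : 'rV[R]_n := \row_(i < n) rmem s 3 i.

End Semantics.

(* Main.v *)
Require Import Defs.
From HB Require Import structures.
From mathcomp Require Import all_boot all_order all_algebra.
From mathcomp Require Import all_classical all_reals all_analysis.
From mathcomp Require Import zify ring lra.

Set Implicit Arguments.
Unset Strict Implicit.
Unset Printing Implicit Defensive.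

Import Order.TTheory GRing.Theory Num.Theory.
Import numFieldNormedType.Exports.

Local Open Scope classical_set_scope.
Local Open Scope ring_scope.

(** Coordinates with |x_i| > Delta must be nonzero in C.  On the others, let the
   gain be w_i^2 - (w_i - c_i)^2, where c_i is the projection of w_i onto
   [x_i - Delta, x_i + Delta].  It is optimal to set y_i = c_i on the forced
   coordinates and on the free ones with the largest gains, up to k in total,
   and y_i = 0 elsewhere.  The largest gains are extracted one by one from a
   tournament tree, which is built in O(n) steps and repaired in O(log n) steps
   along the path from a leaf to the root. *)

(** * Optimality of the largest gains *)

Section Optimality.
Context {R : realType}.
Implicit Types D x w z : R.

Definition clamp D x w : R :=
  let v := if w <= x - D then x - D else w in
  if x + D <= v then x + D else v.

Definition gain D x w : R := w * w - (w - clamp D x w) * (w - clamp D x w).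

Lemma clamp_box D x w : 0 <= D -> `|clamp D x w - x| <= D.
Proof.
move=> D0; rewrite ler_norml /clamp /=.
by case: (lerP w); case: (lerP (x + D)) => ? ?; apply/andP; split; lra.
Qed.

Lemma clamp_closest D x w z : 0 <= D -> `|z - x| <= D ->
  (w - clamp D x w) ^+ 2 <= (w - z) ^+ 2.
Proof.
move=> D0; rewrite ler_norml => /andP[z1 z2]; rewrite -subr_ge0 /clamp /=.
set c := (X in _ - (w - X) ^+ 2).
(* When [c] is an end of the interval, both factors have the same sign. Otherwise [c = w] and the
   product is the square of [z - w]. *)
have -> : (w - z) ^+ 2 - (w - c) ^+ 2 = (z - c) * (z + c - w - w) by ring.
rewrite /c; case: (lerP w) => ?; case: (lerP (x + D)) => ?.
- apply: mulr_ge0; lra.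
- apply: mulr_ge0; lra.
- apply: mulr_le0; lra.
- have -> : z + w - w - w = z - w by ring.
  exact: sqr_ge0.
Qed.

(** When [|x| <= D], the value 0 lies in the interval, so the clamp is at least as close to [w] as 0
    is. *)
Lemma gain_ge0 D x w : 0 <= D -> `|x| <= D -> 0 <= gain D x w.
Proof.
move=> D0 xD; rewrite /gain subr_ge0 -!expr2.
by rewrite -[leRHS](congr1 (fun u => u ^+ 2) (subr0 w)) clamp_closest// sub0r normrN.
Qed.

Lemma boxP n (x y : 'rV[R]_n) D : 0 <= D ->
  box x D y <-> forall i, `|y 0 i - x 0 i| <= D.
Proof.
move=> D0; rewrite /box /= /Num.Def.normr /= mx_normrE; split => [yx i|yx].
  apply: le_trans yx.
  by have := le_bigmax 0 (fun ij => `|(y - x) ij.1 ij.2|) (ord0, i); rewrite !mxE.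
by apply: bigmax_le => // -[i j] _ /=; rewrite !mxE ord1; exact: yx.
Qed.

(* Lagrangian argument: with tau the largest gain outside S, the row minimizes
   (w_i - z_i)^2 + tau * [z_i != 0] separately in each coordinate, and
   #|S| >= #|support z| for every feasible z unless tau = 0. *)
Lemma projections_top_gains n k (x w : 'rV[R]_n) D (S : {set 'I_n}) :
  0 <= D ->
  (forall i, D < `|x 0 i| -> i \in S) ->
  (forall i j, i \in S -> `|x 0 i| <= D -> j \notin S ->
     gain D (x 0 j) (w 0 j) <= gain D (x 0 i) (w 0 i)) ->
  (#|S| <= k)%N -> (#|S| = k \/ S = [set: 'I_n]%SET) ->
  projections k x D w
    (\row_i if i \in S then clamp D (x 0 i) (w 0 i) else 0).
Proof.
move=> D0 forcedS topS Sk fullS.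
set y := \row_i _.
pose g i := gain D (x 0 i) (w 0 i).
(* The default 0 makes [tau] nonnegative, and makes it vanish when [S] contains every index. *)
pose tau := \big[Num.max/0]_(j | j \notin S) g j.
have tau0 : 0 <= tau by exact: bigmax_ge_id.
have tau_ge j : j \notin S -> g j <= tau by move=> jS; apply: le_bigmax_cond.
have tau_le i : i \in S -> `|x 0 i| <= D -> tau <= g i.
  by move=> iS xi; apply: bigmax_le => [|j jS]; [exact: gain_ge0|exact: topS].
split; first split.
- rewrite /sparse /=; apply: leq_trans Sk; apply/subset_leq_card/fintype.subsetP => i.
  by rewrite inE mxE; case: ifP => // _; rewrite eqxx.
- apply/boxP => // i; rewrite mxE; case: ifPn => iS; first exact: clamp_box.
  by rewrite sub0r normrN leNgt; apply: contra iS; exact: forcedS.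
move=> z [zk /boxP zx]; have {}zx := zx D0.
rewrite /norm2 ler_wsqrtr//.
(* If [i] is in [S] and [z_i = 0], feasibility of [z] gives [|x_i| <= D], so the gain is at least
   [tau]. If [i] is outside [S] and [z_i] is nonzero, the gain is at most [tau]. When [i] is in [S]
   and [z_i] is nonzero, closeness of the clamp suffices; the last case is an equality. *)
have term i : (w - y) 0 i ^+ 2 + tau * (i \in S)%:R <=
              (w - z) 0 i ^+ 2 + tau * (z 0 i != 0)%:R.
  rewrite !mxE; have := clamp_closest (w 0 i) D0 (zx i).
  have := tau_le i; have := tau_ge i; have := zx i; rewrite /g /gain.
  case: (i \in S) => /=; case: eqVneq => [->|zi] /=.
  - rewrite sub0r normrN => xi _ /(_ isT xi); rewrite !expr2; lra.
  - rewrite !expr2; lra.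
  - by move=> *; lra.
  - move=> _ /(_ isT) ? _; rewrite !expr2; lra.
have cardE (A : {pred 'I_n}) : #|A|%:R = \sum_i (i \in A)%:R :> R.
  rewrite -sum1_card natr_sum big_mkcond; apply: eq_bigr => i _.
  by case: (i \in A).
have : \sum_i (w - y) 0 i ^+ 2 + tau * #|S|%:R <=
       \sum_i (w - z) 0 i ^+ 2 + tau * #|[pred i | z 0 i != 0]|%:R.
  rewrite !cardE !mulr_sumr -!big_split /=.
  by apply: ler_sum => i _; have := term i; rewrite inE.
suff : tau * #|[pred i | z 0 i != 0]|%:R <= tau * #|S|%:R by lra.
case: fullS => [->|ST]; first by rewrite ler_wpM2l// ler_nat.
have -> : tau = 0 by apply: big_pred0 => i; rewrite ST finset.in_setT.
by rewrite !mul0r.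
Qed.

End Optimality.

(** * Cost-aware Hoare rules *)

Section Hoare.
Context {R : realType}.
Implicit Types (s : state R) (Q : state R -> Prop).

Definition runs c s (K : nat) Q :=
  exists t s', [/\ exec c s t s', (t <= K)%N & Q s'].

Lemma runs_weaken c s K K' Q Q' : runs c s K Q -> (K <= K')%N ->
  (forall s', Q s' -> Q' s') -> runs c s K' Q'.
Proof.
move=> [t [s' [e tK q]]] KK' QQ'; exists t, s'; split => //; last exact: QQ'.
exact: leq_trans tK KK'.
Qed.

Lemma runs_seq c1 c2 s K1 K2 Q1 Q : runs c1 s K1 Q1 ->
  (forall s', Q1 s' -> runs c2 s' K2 Q) -> runs (Seq c1 c2) s (K1 + K2) Q.
Proof.
move=> [t1 [s1 [e1 h1 q1]]] /(_ _ q1) [t2 [s2 [e2 h2 q2]]].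
by exists (t1 + t2)%N, s2; split; [exact: exec_seq e2|exact: leq_add|].
Qed.

Definition loop_cost b K m : nat := (m * (bcost b + K).+1 + (bcost b).+1)%N.

(** The variant [V] bounds the number of iterations; the summand of [loop_cost] outside the product
    pays for the final failing test. *)
Lemma runs_while b c K (Inv : state R -> Prop) (V : state R -> nat) :
  (forall s, Inv s -> beval s b ->
     runs c s K (fun s' => Inv s' /\ (V s' < V s)%N)) ->
  forall s, Inv s ->
    runs (While b c) s (loop_cost b K (V s)) (fun s' => Inv s' /\ ~~ beval s' b).
Proof.
rewrite /loop_cost => body s; have [m] := ubnP (V s).
elim: m s => // m IH s Vs Is.
have [bs|bs] := boolP (beval s b); last first.
  by exists (bcost b).+1, s; split; [exact: exec_while_false|lia|].
have [t1 [s1 [e1 h1 [I1 V1]]]] := body s Is bs.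
have [t2 [s2 [e2 h2 q2]]] := IH s1 ltac:(lia) I1.
exists (bcost b + t1 + t2).+1, s2; split => //.
  exact: exec_while_true bs e1 e2.
by nia.
Qed.

Fixpoint straight c : bool :=
  match c with
  | While _ _ => false
  | Seq c1 c2 | If _ c1 c2 => straight c1 && straight c2
  | _ => true
  end.

(* straight_run and straight_cost have junk values on While. *)
Fixpoint straight_run c s : state R :=
  match c with
  | ISet a i e => State (upd (imem s) a (ieval s i) (ieval s e)) (rmem s)
  | RSet a i e => State (imem s) (upd (rmem s) a (ieval s i) (reval s e))
  | Seq c1 c2 => straight_run c2 (straight_run c1 s)
  | If b c1 c2 => if beval s b then straight_run c1 s else straight_run c2 s
  | _ => s
  end.

Fixpoint straight_cost c : nat :=
  match c with
  | ISet _ i e => (icost i + icost e).+1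
  | RSet _ i e => (icost i + rcost e).+1
  | Seq c1 c2 => straight_cost c1 + straight_cost c2
  | If b c1 c2 => (bcost b + maxn (straight_cost c1) (straight_cost c2)).+1
  | _ => 1
  end.

(** Turns loop-free code into a function of the state, so that postconditions are checked by
    computation. *)
Lemma runs_straight c s Q : straight c -> Q (straight_run c s) ->
  runs c s (straight_cost c) Q.
Proof.
suff H : straight c -> runs c s (straight_cost c) (eq (straight_run c s)).
  by move=> /H sc Qs; apply: runs_weaken sc _ _ => // s' <-.
elim: c s => /= [|a i e|a i e|c1 IH1 c2 IH2|b c1 IH1 c2 IH2|//] s.
- by exists 1%N, s; split => //; exact: exec_skip.
- by move=> _; do 2 eexists; split; [exact: exec_iset|exact: leqnn|].
- by move=> _; do 2 eexists; split; [exact: exec_rset|exact: leqnn|].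
- move=> /andP[s1 s2]; apply: runs_seq (IH1 _ s1) _ => _ <-; exact: IH2.
- move=> /andP[s1 s2]; case: ifPn => bs.
    have [t [s' [e h q]]] := IH1 s s1; exists (bcost b + t).+1, s'.
    by split; [exact: exec_if_true|rewrite /=; lia|].
  have [t [s' [e h q]]] := IH2 s s2; exists (bcost b + t).+1, s'.
  by split; [exact: exec_if_false|rewrite /=; lia|].
Qed.

End Hoare.

(** * Tournament trees *)

Section Tournament.
Context {R : realType}.
Implicit Types (I : nat -> nat) (g : nat -> R).

(** [I j] is the index that wins at node [j]. The children [2j] and [2j + 1] are written as sums, as
    in the program, whose index expressions have no product. *)
Definition node_ok I g j :=
  [/\ I j = I (j + j)%N \/ I j = I (j + j + 1)%N,
      g (I (j + j)%N) <= g (I j) & g (I (j + j + 1)%N) <= g (I j)].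

Definition proper_ancestor j c := exists d, j = iter d.+1 half c.

Definition leaves_ok n I := forall i, (i < n)%N -> I (n + i)%N = i.

(* The parent of node j is j./2; the nodes 1 .. n-1 are internal and n + i is
   the leaf of i.  This is a tree rooted at 1 for every n >= 1. *)
Definition tree_ok n I g := forall j, (0 < j < n)%N -> node_ok I g j.

Lemma node_ok_eq I I' g g' j :
  I' j = I j -> I' (j + j)%N = I (j + j)%N ->
  I' (j + j + 1)%N = I (j + j + 1)%N ->
  g' (I (j + j)%N) = g (I (j + j)%N) ->
  g' (I (j + j + 1)%N) = g (I (j + j + 1)%N) ->
  node_ok I g j -> node_ok I' g' j.
Proof.
move=> e1 e2 e3 h1 h2 [H l1 l2]; have hj : g' (I j) = g (I j) by case: H => ->.
by split; rewrite ?e1 ?e2 ?e3 ?hj ?h1 ?h2.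
Qed.

(** Induction from the leaves upwards: a winner is copied from a child, so its leaf descends from
    [j]. *)
Lemma winner_in_subtree n I g j : leaves_ok n I -> tree_ok n I g ->
  (0 < j < n + n)%N -> (I j < n)%N /\ exists d, j = iter d half (n + I j)%N.
Proof.
move=> lI tI; have [m] := ubnP (n + n - j)%N.
elim: m j => // m IH j jm jn; case: (ltnP j n) => jn'; last first.
  have Ij : I j = (j - n)%N by rewrite -{1}(subnKC jn') lI//; lia.
  by rewrite Ij subnKC//; split; [lia|exists 0%N].
have [[->|->] _ _] := tI j ltac:(lia).
- have [? [d Hd]] := IH (j + j)%N ltac:(lia) ltac:(lia).
  by split => //; exists d.+1; rewrite iterS -Hd; lia.
- have [? [d Hd]] := IH (j + j + 1)%N ltac:(lia) ltac:(lia).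
  by split => //; exists d.+1; rewrite iterS -Hd; lia.
Qed.

(** On the path from the leaf of [i] to the root, the gain of the stored winner never decreases. *)
Lemma root_is_max n I g i : leaves_ok n I -> tree_ok n I g -> (i < n)%N ->
  g i <= g (I 1).
Proof.
move=> lI tI ni; rewrite -{1}(lI _ ni).
have : (0 < n + i < n + n)%N by lia.
move: (n + i)%N => j; elim/ltn_ind: j => j IH jn.
have [->//|j1] := eqVneq j 1%N.
have := IH j./2 ltac:(lia) ltac:(lia); apply: le_trans.
have [_] := tI j./2 ltac:(lia).
have [->|->] : j = (j./2 + j./2)%N \/ j = (j./2 + j./2 + 1)%N by lia.
- by rewrite (_ : (_ + _)./2 = j./2) //; lia.
by rewrite (_ : (_ + _)./2 = j./2) //; lia.
Qed.

(** The condition at a node involves only the winners of its children. If the new gain of [a]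
    matters there, [a] wins at a child, and the leaf of [a] lies below that child. *)
Lemma tree_ok_away n I g g' a : leaves_ok n I -> tree_ok n I g ->
  (forall i, i != a -> g' i = g i) ->
  forall j, (0 < j < n)%N -> proper_ancestor j (n + a) \/ node_ok I g' j.
Proof.
move=> lI tI g'g j jn.
have child c : (c < n + n)%N -> j = c./2 -> proper_ancestor j (n + a) \/ g' (I c) = g (I c).
  move=> cn jc; have [Ia|/g'g] := eqVneq (I c) a; last by right.
  have [_ [d Hd]] := winner_in_subtree lI tI (j := c) ltac:(lia).
  by left; exists d; rewrite iterS -Ia -Hd.
have [|h1] := child (j + j)%N ltac:(lia) ltac:(lia); first by left.
have [|h2] := child (j + j + 1)%N ltac:(lia) ltac:(lia); first by left.
by right; apply: node_ok_eq (tI j jn).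
Qed.

Lemma no_proper_ancestor1 j : (0 < j)%N -> ~ proper_ancestor j 1.
Proof.
move=> j0 [d]; rewrite iterSr /= => jd.
by have : iter d half 0%N = 0%N; [elim: d {jd} => //= d ->|lia].
Qed.

Lemma proper_ancestor_half j c : proper_ancestor j c ->
  j = c./2 \/ proper_ancestor j c./2.
Proof. by case=> -[|d] ->; [left|right; exists d; rewrite iterSr]. Qed.

End Tournament.

(** * The program *)

Lemma upd_upd V (m : nat -> nat -> V) a i v v' :
  upd (upd m a i v) a i v' = upd m a i v'.
Proof.
by apply/funext => b; apply/funext => j; rewrite /upd; case: (_ && _).
Qed.

Section Program.

Let cst := INum.
Let size := IGet 0 (INum 0).
Let todo := IGet 1 (INum 0).
Let cur := IGet 2 (INum 0).
Let left := IAdd cur cur.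
Let right := IAdd left (cst 1).
Let radius := RGet 0 (INum 0).
Let xc := RGet 1 cur.
Let wc := RGet 2 cur.
Let cc := RGet 4 cur.
Let set_cur e := ISet 2 (INum 0) e.

(* Index arrays: 0 = n, 1 = number of entries still to select, 2 = current
   index or node, 3 = winner of each tree node, 4 = halves.
   Real arrays: 0 = Delta, 1 = x, 2 = w, 3 = y, 4 = clamped w, 5 = gains, where
   -1 marks an index that is forced or already selected. *)

Definition clamp_cur : cmd :=
  Seq (If (BRLe wc (RSub xc radius)) (RSet 4 cur (RSub xc radius)) (RSet 4 cur wc))
      (If (BRLe (RAdd xc radius) cc) (RSet 4 cur (RAdd xc radius)) Skip).

(** The machine has no absolute value, so [|x_i| <= Delta] is tested by two comparisons. *)
Definition classify_cur : cmd :=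
  If (BAnd (BRLe xc radius) (BRLe (RSub (RNum 0) radius) xc))
     (RSet 5 cur (RSub (RMul wc wc) (RMul (RSub wc cc) (RSub wc cc))))
     (Seq (RSet 5 cur (RSub (RNum 0) (RNum 1)))
     (Seq (RSet 3 cur cc)
          (ISet 1 (INum 0) (ISub todo (cst 1))))).

(** Halving is not a machine operation: the parent table is filled by doubling, each [i] being
    stored in cells [2i] and [2i + 1]. *)
Definition init_cur : cmd :=
  Seq (ISet 4 left cur) (Seq (ISet 4 right cur)
  (Seq (ISet 3 (IAdd size cur) cur) (set_cur (IAdd cur (cst 1))))).

Definition init_body := Seq clamp_cur (Seq classify_cur init_cur).
Definition init_test := BNot (BILe size cur).

Definition pull : cmd :=
  If (BRLe (RGet 5 (IGet 3 right)) (RGet 5 (IGet 3 left)))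
     (ISet 3 cur (IGet 3 left)) (ISet 3 cur (IGet 3 right)).

Definition above_root := BNot (BILe cur (cst 1)).
Definition build_body := Seq (set_cur (ISub cur (cst 1))) pull.
Definition climb_body := Seq (set_cur (IGet 4 cur)) pull.

(** The mark -1 is below every gain of a free index, as these are nonnegative. The current cell ends
    at the leaf of the extracted index, where the climb starts. *)
Definition select_cur : cmd :=
  Seq (set_cur (IGet 3 (cst 1)))
  (Seq (RSet 3 cur cc)
  (Seq (RSet 5 cur (RSub (RNum 0) (RNum 1)))
  (Seq (set_cur (IAdd size cur))
       (ISet 1 (INum 0) (ISub todo (cst 1)))))).

Definition select_body := Seq select_cur (While above_root climb_body).
Definition select_test := BNot (BILe todo (cst 0)).

Definition project : cmd :=
  Seq (While init_test init_body)
  (Seq (While above_root build_body)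
       (While select_test select_body)).

End Program.

(** * Building and repairing the tournament tree *)

Section Tree.
Context {R : realType}.
Implicit Types s : state R.

(** What work on the tree preserves: it writes only the current node and the winners of internal
    nodes. *)
Definition frame n m (r : nat -> nat -> R) s :=
  [/\ rmem s = r, imem s 0 0 = n, imem s 1 0 = m, leaves_ok n (imem s 3) &
      forall j, (j < n + n)%N -> imem s 4 j = j./2].

(** For [j > 0] both children differ from [j], so writing the winner does not disturb the entries
    just compared. *)
Lemma pull_run s (j := imem s 2 0) : (0 < j)%N -> exists v,
  straight_run pull s = State (upd (imem s) 3 j v) (rmem s) /\
  node_ok (upd (imem s) 3 j v 3) (rmem s 5) j.
Proof.
move=> j0; rewrite /pull /= -/j.
have e1 v : upd (imem s) 3 j v 3 j = v by rewrite /upd !eqxx.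
have e2 v : upd (imem s) 3 j v 3 (j + j)%N = imem s 3 (j + j)%N.
  by rewrite /upd eqxx /= ifN//; lia.
have e3 v : upd (imem s) 3 j v 3 (j + j + 1)%N = imem s 3 (j + j + 1)%N.
  by rewrite /upd eqxx /= ifN//; lia.
case: lerP => h; eexists; (split; first reflexivity);
  rewrite /node_ok e1 e2 e3; split => //.
- by left.
- by right.
by rewrite ltW.
Qed.

Lemma upd_winner_node_ok I j j' v (g : nat -> R) :
  j' != j -> (j' + j')%N != j -> (j' + j' + 1)%N != j ->
  node_ok (I 3) g j' -> node_ok (upd I 3 j v 3) g j'.
Proof.
by move=> n1 n2 n3; apply: node_ok_eq => //; rewrite /upd eqxx /= ifN.
Qed.

Lemma upd_winner_leaves_ok n I j v : (j < n)%N -> leaves_ok n (I 3) ->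
  leaves_ok n (upd I 3 j v 3).
Proof. by move=> jn lI i ni; rewrite /upd eqxx /= ifN ?lI//; lia. Qed.

(** Nodes are settled from [n - 1] down to 1, so the children of a node, having larger numbers, are
    settled before it. *)
Lemma build_runs n m r s : (0 < n)%N -> frame n m r s -> imem s 2 0 = n ->
  runs (While above_root build_body) s
    (loop_cost above_root (straight_cost build_body) n)
    (fun s' => frame n m r s' /\ tree_ok n (imem s' 3) (r 5)).
Proof.
move=> n0 fs sn.
pose Inv s' := [/\ frame n m r s', (0 < imem s' 2 0 <= n)%N &
  forall j, (imem s' 2 0 <= j < n)%N -> node_ok (imem s' 3) (r 5) j].
have body s' : Inv s' -> beval s' above_root -> runs build_body s'
    (straight_cost build_body)
    (fun s2 => Inv s2 /\ (imem s2 2 0 < imem s' 2 0)%N).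
  move=> [[f1 f2 f3 f4 f5] cn tj]; rewrite /= => c1.
  apply: runs_straight => //.
  pose s1 := State (upd (imem s') 2 0 (imem s' 2 0 - 1)%N) (rmem s').
  rewrite -[straight_run _ _]/(straight_run pull s1).
  have s1c : imem s1 2 0 = (imem s' 2 0 - 1)%N by [].
  have [v [-> vok]] := @pull_run s1 ltac:(lia).
  split; last by change (imem s' 2 0 - 1 < imem s' 2 0)%N; lia.
  split; [split => //| |].
  - apply: (upd_winner_leaves_ok (I := imem s1)) => //; lia.
  - by change (0 < imem s' 2 0 - 1 <= n)%N; lia.
  - change (forall j, (imem s' 2 0 - 1 <= j < n)%N ->
      node_ok (upd (imem s1) 3 (imem s1 2 0) v 3) (r 5) j) => j jn.
    have [->|jc] := eqVneq j (imem s1 2 0); first by rewrite -f1.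
    by apply: (upd_winner_node_ok (I := imem s1)); [..|apply: tj]; lia.
have Is : Inv s by split => //; rewrite ?sn; lia.
rewrite -[X in loop_cost _ _ X]sn.
apply: runs_weaken (runs_while (V := fun s' => imem s' 2 0) body Is) _ _ => //.
move=> s' [[Ic In It] b].
split => // j jn; apply: It; move: b; rewrite /=; lia.
Qed.

(** Invariant: only proper ancestors of the current node may be wrong, and the root has none. Moving
    to the parent lowers the binary logarithm of the node by one, which bounds the iterations. *)
Lemma climb_runs n m r s : frame n m r s -> (0 < imem s 2 0 < n + n)%N ->
  (forall j, (0 < j < n)%N ->
     proper_ancestor j (imem s 2 0) \/ node_ok (imem s 3) (r 5) j) ->
  runs (While above_root climb_body) s
    (loop_cost above_root (straight_cost climb_body) (trunc_log 2 (imem s 2 0)))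
    (fun s' => frame n m r s' /\ tree_ok n (imem s' 3) (r 5)).
Proof.
move=> fs sn st.
pose Inv s' := [/\ frame n m r s', (0 < imem s' 2 0 < n + n)%N &
  forall j, (0 < j < n)%N ->
     proper_ancestor j (imem s' 2 0) \/ node_ok (imem s' 3) (r 5) j].
have body s' : Inv s' -> beval s' above_root -> runs climb_body s'
    (straight_cost climb_body)
    (fun s2 => Inv s2 /\
      (trunc_log 2 (imem s2 2 0) < trunc_log 2 (imem s' 2 0))%N).
  move=> [[f1 f2 f3 f4 f5] cn tj]; rewrite /= => c1.
  apply: runs_straight => //.
  pose s1 := State (upd (imem s') 2 0 (imem s' 4 (imem s' 2 0))) (rmem s').
  rewrite -[straight_run _ _]/(straight_run pull s1).
  have s1c : imem s1 2 0 = (imem s' 2 0)./2 by rewrite -f5//; lia.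
  have [v [-> vok]] := @pull_run s1 ltac:(lia).
  have s2c : imem (State (upd (imem s1) 3 (imem s1 2 0) v) (rmem s1)) 2 0 =
    (imem s' 2 0)./2 by [].
  split; last by rewrite s2c [X in (_ < X)%N]trunc_log2S//; lia.
  split; [split => //| |].
  - by apply: (upd_winner_leaves_ok (I := imem s1)) => //; lia.
  - by rewrite s2c; lia.
  - rewrite s2c => j jn.
    have [jc|jc] := eqVneq j (imem s1 2 0); first by right; rewrite -f1 jc.
    have [pa|nok] := tj j jn.
      by have [|] := proper_ancestor_half pa; [lia|left].
    (* Changing the winner at the current node can also spoil its parent, but that is a proper
       ancestor and remains to be repaired. *)
    have [jc'|jc'] := eqVneq j (imem s1 2 0)./2.
      by left; exists 0%N; rewrite jc' s1c.
    by right; apply: (upd_winner_node_ok (I := imem s1)) => //; lia.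
have Is : Inv s by [].
apply: runs_weaken (runs_while (V := fun s' => trunc_log 2 (imem s' 2 0)) body Is) _ _ => //.
move=> s' [[Ic In It] b]; split => // j jn.
have c1 : imem s' 2 0 = 1%N by move: b; rewrite /=; lia.
have [|//] := It j jn; rewrite c1 => /no_proper_ancestor1; case; lia.
Qed.

End Tree.

(** * Extracting the largest gains *)

Section Selection.
Context {R : realType} (n k : nat) (D : R) (x w : 'rV[R]_n) (D0 : 0 <= D).
Let c i := clamp D (x 0 i) (w 0 i).
Let g i := gain D (x 0 i) (w 0 i).

(** [S] collects the forced and the already selected indices, and [m] selections remain. Once [S]
    contains every index, further rounds lower [m] without enlarging [S], whence the inequality in
    the last clause. *)
Definition selected m (r : nat -> nat -> R) :=
  (forall i : 'I_n, r 4 i = c i) /\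
  exists S : {set 'I_n},
  [/\ forall i : 'I_n, r 3 i = if i \in S then c i else 0,
      forall i : 'I_n, r 5 i = if i \in S then - 1 else g i,
      forall i, D < `|x 0 i| -> i \in S,
      forall i j, i \in S -> `|x 0 i| <= D -> j \notin S -> g j <= g i &
      (#|S| + m = k \/ #|S| + m <= k /\ S = [set: 'I_n]%SET)%N].

(* If a is already selected, its gain -1 is maximal, so all indices are selected
   and selecting a again is harmless: the program need not test for this. *)
Lemma selected_step m r (a : 'I_n) : selected m.+1 r ->
  (forall j : 'I_n, r 5 j <= r 5 a) ->
  selected m (upd (upd r 3 a (r 4 a)) 5 a (- 1)).
Proof.
move=> [r4 [S [r3 r5 forcedS topS cardS]]] maxa.
split=> [i|]; first by rewrite -r4 /upd.
have [aS|aS] := boolP (a \in S).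
  have ST : S = [set: 'I_n]%SET.
    apply/setP => j; rewrite [RHS]inE; apply/negPn/negP => jS.
    have xj : `|x 0 j| <= D by rewrite leNgt; apply: contra jS; exact: forcedS.
    have := maxa j; rewrite !r5 aS (negPf jS) /g.
    have := gain_ge0 (w 0 j) D0 xj; lra.
  exists S; split => // [i|i|].
  - rewrite /upd /= r4; case: ifP => [/eqP/val_inj ->|_]; last exact: r3.
    by rewrite aS.
  - by rewrite /upd /=; case: ifP => [/eqP/val_inj ->|_]; rewrite ?aS ?r5.
  by right; split => //; lia.
exists (a |: S)%SET; split => [i|i|i xi|i j|].
- rewrite /upd /= r4 in_setU1; case: (eqVneq i a) => [->|ia]; first by rewrite eqxx.
  by rewrite ifN ?r3.
- rewrite /upd /= in_setU1; case: (eqVneq i a) => [->|ia]; first by rewrite eqxx.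
  by rewrite ifN ?r5.
- by rewrite in_setU1 forcedS ?orbT.
- rewrite !in_setU1 negb_or => /orP[/eqP ->|iS] xi /andP[ja jS]; last exact: topS.
  by have := maxa j; rewrite !r5 (negPf aS) (negPf jS).
left; rewrite cardsU1 aS; case: cardS => [|[_ ST]]; first by lia.
by rewrite ST inE in aS.
Qed.

Lemma selected_output r (s : state R) : rmem s = r -> selected 0 r ->
  projections k x D w (output n s).
Proof.
move=> sr [r4 [S [r3 r5 forcedS topS cardS]]].
have -> : output n s = \row_i if i \in S then c i else 0.
  by apply/rowP => i; rewrite !mxE sr r3.
by apply: projections_top_gains => //; move: cardS; rewrite addn0;
  [case=> [->|[]]|case=> [|[]]; [left|right]].
Qed.

Lemma select_cur_run (s : state R) (a := imem s 3 1) :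
  straight_run select_cur s =
  State (upd (upd (imem s) 2 0 (imem s 0 0 + a)%N) 1 0 (imem s 1 0 - 1)%N)
        (upd (upd (rmem s) 3 a (rmem s 4 a)) 5 a (- 1)).
Proof. by rewrite /= sub0r upd_upd. Qed.

(** The extra 1 in the logarithm is there because the climb starts at a leaf [n + a], which is less
    than [2n]. *)
Definition select_cost n : nat :=
  (straight_cost select_cur +
   loop_cost above_root (straight_cost climb_body) (trunc_log 2 n).+1)%N.

Lemma select_runs m r (s : state R) : (0 < n)%N -> frame n m r s ->
  tree_ok n (imem s 3) (r 5) -> selected m r ->
  runs (While select_test select_body) s
    (loop_cost select_test (select_cost n) m)
    (fun s' => projections k x D w (output n s')).
Proof.
move=> n0 fs ts ss.
pose Inv s' := [/\ frame n (imem s' 1 0) (rmem s') s',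
  tree_ok n (imem s' 3) (rmem s' 5) & selected (imem s' 1 0) (rmem s')].
have body s' : Inv s' -> beval s' select_test -> runs select_body s'
    (select_cost n) (fun s2 => Inv s2 /\ (imem s2 1 0 < imem s' 1 0)%N).
  move=> [[_ f2 _ f4 f5] ts' ss'] /= m0.
  set m' := imem s' 1 0 in m0 ss' *.
  have [an _] := winner_in_subtree f4 ts' (j := 1) ltac:(lia).
  set a := imem s' 3 1 in an.
  pose Q s1 := frame n (m' - 1) (upd (upd (rmem s') 3 a (rmem s' 4 a)) 5 a (- 1)) s1 /\
    imem s1 2 0 = (n + a)%N /\ imem s1 3 = imem s' 3.
  apply: (runs_seq (Q1 := Q)).
    by apply: runs_straight => //; rewrite select_cur_run -/a f2.
  move=> s1 [fs1 [s1c s13]].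
  set r1 := upd _ 5 a _ in fs1.
  apply: (@runs_weaken _ _ _ _ _ _ _ (climb_runs fs1 _ _)).
  - by rewrite s1c; lia.
  (* Only the gain of [a] has changed, so only ancestors of its leaf can be wrong. *)
  - move=> j jn; rewrite s1c s13; apply: tree_ok_away ts' _ _ jn => // i ia.
    by rewrite /r1 /upd /= (negPf ia).
  - rewrite s1c /loop_cost leq_add2r leq_mul2r; apply/orP; right.
    rewrite -trunc_log2_double//; apply: leq_trunc_log; lia.
  move=> s2 [fs2 ts2]; have [e2 _ e3 _ _] := fs2.
  split; last by rewrite e3; lia.
  split; rewrite e2 ?e3//.
  have mE : m' = (m' - 1).+1 by lia.
  rewrite mE in ss'.
  apply: (selected_step (a := Ordinal an) ss') => j.
  exact: (root_is_max f4).
have Is : Inv s by case: (fs) => e1 _ e2 _ _; split; rewrite e1 ?e2.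
case: (fs) => _ _ sm _ _; rewrite -[X in loop_cost _ _ X]sm.
apply: runs_weaken (runs_while (V := fun s' => imem s' 1 0) body Is) _ _ => //.
move=> s' [[_ _ s's] b]; apply: selected_output erefl _.
by have <- : imem s' 1 0 = 0%N by move: b => /=; lia.
Qed.

End Selection.

(** * The initial scan *)

Section Init.
Context {R : realType} (n k : nat) (D : R) (X W : nat -> R).
Let c i := clamp D (X i) (W i).
Let g i := gain D (X i) (W i).
Let forced i := D < `|X i|.

(** The last clause keeps the unscanned output cells at 0; free indices retain this 0 unless
    selected later. *)
Definition init_inv (s : state R) :=
  let i := imem s 2 0 in
  [/\ [/\ rmem s 0 0 = D, rmem s 1 = X & rmem s 2 = W],
      [/\ imem s 0 0 = n, (i <= n)%N &
          imem s 1 0 = (k - \sum_(0 <= j < i) forced j)%N],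
      forall j, (j < i)%N -> imem s 3 (n + j) = j,
      forall j, (j < i + i)%N -> imem s 4 j = j./2 &
      forall j, if (j < i)%N then
        [/\ rmem s 4 j = c j, rmem s 3 j = if forced j then c j else 0 &
            rmem s 5 j = if forced j then - 1 else g j]
        else rmem s 3 j = 0].

Lemma clamp_cur_run (s : state R) (i := imem s 2 0) :
  straight_run clamp_cur s =
  State (imem s) (upd (rmem s) 4 i (clamp (rmem s 0 0) (rmem s 1 i) (rmem s 2 i))).
Proof.
have updE v : upd (rmem s) 4 i v 4 i = v by rewrite /upd !eqxx.
have dbl v : (if rmem s 1 i + rmem s 0 0 <= v
    then State (imem s) (upd (upd (rmem s) 4 i v) 4 i (rmem s 1 i + rmem s 0 0))
    else State (imem s) (upd (rmem s) 4 i v)) =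
  State (imem s) (upd (rmem s) 4 i
    (if rmem s 1 i + rmem s 0 0 <= v then rmem s 1 i + rmem s 0 0 else v)).
  by case: ifP; rewrite ?upd_upd.
rewrite /clamp /= -/i -dbl.
by case: (rmem s 2 i <= _) => /=; rewrite -/i updE.
Qed.

Lemma classify_cur_run (I : nat -> nat -> nat) (r : nat -> nat -> R) (i := I 2 0) :
  straight_run classify_cur (State I r) =
  if r 0%N 0 < `|r 1%N i| then
    State (upd I 1 0 (I 1 0 - 1)%N) (upd (upd r 5 i (- 1)) 3 i (r 4 i))
  else
    State I (upd r 5 i (r 2 i * r 2 i - (r 2 i - r 4 i) * (r 2 i - r 4 i))).
Proof.
rewrite /= -/i ltNge ler_norml sub0r [in RHS]andbC sub0r.
by case: (_ && _).
Qed.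

(** Reading the boolean [forced i] as 0 or 1 gives the counter a single description for both
    branches. *)
Lemma scan_cur_run (s : state R) (i := imem s 2 0) :
  rmem s 0 0 = D -> rmem s 1 = X -> rmem s 2 = W -> exists r,
  [/\ straight_run classify_cur (straight_run clamp_cur s) =
        State (upd (imem s) 1 0 (imem s 1 0 - forced i)%N) r,
      [/\ r 0%N = rmem s 0, r 1%N = rmem s 1 & r 2 = rmem s 2],
      forall a j, j != i -> r a j = rmem s a j &
      [/\ r 4 i = c i, r 3 i = if forced i then c i else rmem s 3 i &
          r 5 i = if forced i then - 1 else g i]].
Proof.
move=> rD rX rW; rewrite clamp_cur_run classify_cur_run -/i.
set r1 := upd _ 4 i _.
have -> : r1 0%N 0 = D by rewrite -rD.
have -> : r1 1%N i = X i by rewrite -rX.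
have -> : r1 2 i = W i by rewrite -rW.
have r14 : r1 4 i = c i by rewrite /r1 /upd !eqxx rD rX rW.
have r1i a j : j != i -> r1 a j = rmem s a j.
  by move=> /negPf ji; rewrite /r1 /upd ji andbF.
have updE I : upd I 1 0 (I 1 0 - false)%N = I.
  apply/funext => b; apply/funext => j; rewrite /upd.
  by case: ifP => // /andP[/eqP -> /eqP ->]; rewrite /= subn0.
rewrite r14 /forced; case: ifP => _; rewrite ?updE; eexists;
  (split; first reflexivity) => //.
- by move=> a j ji; rewrite -r1i// /upd (negPf ji) !andbF.
- by split; rewrite /upd /= ?eqxx.
- by move=> a j ji; rewrite -r1i// /upd (negPf ji) !andbF.
- by split; rewrite /upd /= ?eqxx.
Qed.

Lemma init_runs (s : state R) : init_inv s -> imem s 2 0 = 0%N ->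
  runs (While init_test init_body) s
    (loop_cost init_test (straight_cost init_body) n)
    (fun s' => init_inv s' /\ imem s' 2 0 = n).
Proof.
move=> Is s0.
have body s' : init_inv s' -> beval s' init_test ->
    runs init_body s' (straight_cost init_body)
    (fun s2 => init_inv s2 /\ (n - imem s2 2 0 < n - imem s' 2 0)%N).
  move=> [[rD rX rW] [sn ile sk] s3 s4 r345]; rewrite /= sn -ltnNge => iltn.
  apply: runs_straight => //.
  rewrite -[straight_run _ _]/(straight_run init_cur
    (straight_run classify_cur (straight_run clamp_cur s'))).
  have [r [-> [r0 r1 r2] rother [r4 r3 r5]]] := scan_cur_run rD rX rW.
  move: iltn ile sk s3 s4 r345 rother r4 r3 r5.
  set i := imem s' 2 0 => iltn ile sk s3 s4 r345 rother r4 r3 r5.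
  set s2 := straight_run _ _.
  have s2i : imem s2 2 0 = (i + 1)%N by [].
  rewrite /init_inv s2i; split; last by lia.
  split.
  - by split; [rewrite -rD -r0|rewrite -rX -r1|rewrite -rW -r2].
  - split; [exact: sn|lia|].
    by rewrite addn1 big_nat_recr//= subnDA -sk.
  - move=> j ji.
    change (upd (imem s') 3 (imem s' 0 0 + i)%N i 3 (n + j)%N = j).
    rewrite sn /upd /= eqn_add2l.
    by case: eqVneq => // jni; apply: s3; lia.
  - move=> j ji.
    change (upd (upd (imem s') 4 (i + i)%N i) 4 (i + i + 1)%N i 4 j = j./2).
    rewrite /upd /=.
    case: eqVneq => [|j1]; first by lia.
    case: eqVneq => [|j2]; first by lia.
    by apply: s4; lia.
  - move=> j; change (rmem s2) with r.
    have [->|ji] := eqVneq j i.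
      rewrite addn1 ltnSn r4 r3 r5; split => //.
      by have := r345 i; rewrite ltnn => ->.
    have := r345 j; rewrite !rother//.
    by have -> : (j < i + 1)%N = (j < i)%N by lia.
have Vs : (n - imem s 2 0)%N = n by rewrite s0 subn0.
rewrite -[X in loop_cost _ _ X]Vs.
apply: runs_weaken (runs_while (V := fun s' => (n - imem s' 2 0)%N) body Is) _ _ => //.
move=> s' [Is' b]; split => //.
by case: Is' => _ [sn' ile _] _ _ _; move: b; rewrite /= sn'; lia.
Qed.

End Init.

(** * Asymptotics of the cost bound *)

Lemma trunc_log2_le_ln (R : realType) n : (0 < n)%N ->
  (trunc_log 2 n)%:R * ln 2 <= ln (n%:R : R).
Proof.
move=> n0; rewrite mulr_natl -lnXn// -natrX ler_ln ?posrE ?ltr0n ?expn_gt0//.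
by rewrite ler_nat trunc_logP.
Qed.

Lemma linearithmic_bigO (R : realType) (K : nat) :
  (fun n : nat => (K * n * (trunc_log 2 n).+1)%:R : R) =O_\oo
  (fun n : nat => n%:R * ln n%:R).
Proof.
have ln2 : 0 < ln 2 :> R by rewrite ln_gt0// ltr1n.
(* For [n >= 2], [ln 2 <= ln n] absorbs the successor: the integer logarithm plus one is at most
   [2 ln n / ln 2]. Adding 1 to [K] keeps the constant positive. *)
apply/eqO_exP; exists ((K%:R + 1) * (2 / ln 2)).
  by rewrite mulr_gt0 ?divr_gt0// ltr_wpDl.
near=> n.
have n2 : (2 <= n)%N by near: n; exact: nbhs_infty_ge.
have lnn : ln 2 <= ln n%:R :> R by rewrite ler_ln ?posrE ?ltr0n ?ler_nat ?(ltnW n2).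
rewrite !ger0_norm ?mulr_ge0 ?ler0n// ?(le_trans _ lnn)// ?(ltW ln2)//.
have tl := @trunc_log2_le_ln R n (ltnW n2).
have {}tl : (trunc_log 2 n).+1%:R <= 2 / ln 2 * ln n%:R :> R.
  by rewrite mulrAC ler_pdivlMr// -natr1 mulrDl mul1r; lra.
rewrite [leRHS]mulrACA natrM natrM ler_pM ?mulr_ge0//.
by rewrite ler_wpM2r// lerDl.
Unshelve. all: by end_near.
Qed.

(** * Correctness and cost of the whole program *)

Lemma store_rowE (R : realType) n (x : 'rV[R]_n) (i : 'I_n) : store_row x i = x 0 i.
Proof. by rewrite /store_row valK. Qed.

Lemma init_inv_input (R : realType) n k (D : R) (x w : 'rV[R]_n) :
  init_inv n k D (store_row x) (store_row w) (input k D x w).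
Proof. by split => //; split; rewrite // big_geq// subn0. Qed.

(** After the scan [S] is exactly the forced set, so the comparison of gains is vacuous: [S] has no
    free index. *)
Lemma init_inv_selected (R : realType) n k (D : R) (x w : 'rV[R]_n) (s : state R) :
  sparse k x -> 0 <= D -> init_inv n k D (store_row x) (store_row w) s ->
  imem s 2 0 = n -> selected k D x w (imem s 1 0) (rmem s).
Proof.
move=> xk D0 [_ [_ _ m] _ _ r345] sn; rewrite sn in m.
have {}r345 (i : 'I_n) := r345 i; move: r345; rewrite sn => r345.
split=> [i|]; first by have := r345 i; rewrite ltn_ord !store_rowE => -[].
exists [set i | D < `|x 0 i|]%SET; split.
- by move=> i; have := r345 i; rewrite ltn_ord !store_rowE inE => -[].
- by move=> i; have := r345 i; rewrite ltn_ord !store_rowE inE => -[].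
- by move=> i; rewrite inE.
- by move=> i j; rewrite inE ltNge => /negP.
left; rewrite m.
have -> : (\sum_(0 <= j < n) (D < `|store_row x j|)%R = #|[set i | (D < `|x 0 i|)%R]%SET|)%N.
  rewrite big_mkord -sum1_card [RHS]big_mkcond; apply: eq_bigr => i _.
  by rewrite inE store_rowE; case: ifP.
(* The truncated subtraction is exact: forced entries of [x] are nonzero, so sparsity bounds their
   number by [k]. *)
rewrite subnKC//; apply: leq_trans xk; apply/subset_leq_card/fintype.subsetP => i.
by rewrite !inE => xi; rewrite -normr_gt0 (le_lt_trans D0).
Qed.

Definition project_cost n m : nat :=
  (loop_cost init_test (straight_cost init_body) n +
   (loop_cost above_root (straight_cost build_body) n +
    loop_cost select_test (select_cost n) m))%N.

Lemma project_runs (R : realType) n k (D : R) (x w : 'rV[R]_n) :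
  (0 < n)%N -> 0 <= D -> sparse k x ->
  runs project (input k D x w) (project_cost n k)
    (fun s => projections k x D w (output n s)).
Proof.
move=> n0 D0 xk.
apply: runs_seq (init_runs (init_inv_input k D x w) erefl) _ => s [Is sn].
have sel := init_inv_selected xk D0 Is sn.
have fs : frame n (imem s 1 0) (rmem s) s.
  by case: Is; rewrite sn => _ [s0 _ _] lI half _; split.
apply: runs_seq (build_runs n0 fs sn) _ => s2 [fs2 ts2].
apply: runs_weaken (select_runs D0 n0 fs2 ts2 sel) _ _ => //.
(* Forced indices have already used some of the [k] places, so at most [k] rounds remain. *)
rewrite /loop_cost leq_add2r leq_mul2r.
by case: Is => _ [_ _ ->] _ _ _; rewrite leq_subr orbT.
Qed.

Lemma project_cost_le n k : (0 < n)%N -> (k <= n)%N ->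
  (project_cost n k <= 1000 * n * (trunc_log 2 n).+1)%N.
Proof.
move=> n0 kn; rewrite /project_cost /select_cost /loop_cost /=.
set L := trunc_log 2 n.
nia.
Qed.

Theorem mainTheorem1 (R : realType) :
  exists (prog : cmd) (T : nat -> R),
    T =O_\oo (fun n : nat => n%:R * ln n%:R) /\
    forall (n k : nat) (Delta : R) (x w : 'rV[R]_n),
      (1 <= n)%N -> (k <= n)%N -> 0 <= Delta -> sparse k x ->
      exists (t : nat) (s : state R),
        [/\ exec prog (input k Delta x w) t s,
            projections k x Delta w (output n s) &
            t%:R <= T n].
Proof.
(* The constant is generous. The successor of the logarithm keeps the bound valid at [n = 1], where
   the logarithm vanishes. *)
exists project, (fun n => (1000 * n * (trunc_log 2 n).+1)%:R).
split; first exact: linearithmic_bigO.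
move=> n k D x w n0 kn D0 xk.
have [t [s [e tle ps]]] := project_runs w n0 D0 xk.
exists t, s; split => //; rewrite ler_nat (leq_trans tle)//.
exact: project_cost_le.
Qed.
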